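(* Let $n\ge 0$ and let $p$ be an odd prime. Then $o_{2,p}(n)\ge d_{2,p}(n)$ and $o_{2,p}(n)\equiv d_{2,p}(n)\pmod 2$.
   Context: A partition of $n$ is a weakly decreasing finite sequence of positive integers summing to $n$. $\mathcal O(n)$ is the set of partitions of $n$ with all parts odd, and $\mathcal D(n)$ the set of partitions of $n$ with all parts distinct. For a partition $\nu$ and positive integer $i$, $m_\nu(i)$ is the number of parts of $\nu$ equal to $i$. For $\lambda=(\lambda_1,\ldots,\lambda_\ell)$ with $\ell\ge2$, $\mathrm{pre}_2(\lambda)$ is the partition whose parts are the products $\lambda_i\lambda_j$ over all $1\le i<j\le\ell$ (with multiplicity); it is undefined if $\ell<2$. $o_{2,p}(n)$ is the total number of parts equal to $p$ among all partitions in the image $\mathrm{pre}_2(\mathcal O(n))$ (i.e. $\sum m_\nu(p)$ over $\nu=\mathrm{pre}_2(\lambda)$, $\lambda\in\mathcal O(n)$ with at least two parts), and $d_{2,p}(n)$ is defined likewise with $\mathcal D(n)$ in place of $\mathcal O(n)$. *)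

(* Defs.v *)
From HB Require Import structures.
From mathcomp Require Import all_boot.
Set Implicit Arguments.
Unset Strict Implicit.
Unset Printing Implicit Defensive.

Definition is_partition (n : nat) (s : seq nat) : bool :=
  [&& sorted geq s, all (leq 1) s & sumn s == n].

(* Partitions of n with all parts at most k, split according to the
   multiplicity j of the part k. *)
Fixpoint partitions_le (k n : nat) : seq (seq nat) :=
  if k is k'.+1 then
    [seq nseq j k ++ s | j <- iota 0 (n %/ k).+1, s <- partitions_le k' (n - j * k)]
  else if n == 0 then [:: [::]] else [::].

Definition partitions (n : nat) : seq (seq nat) := partitions_le n n.

Definition odd_partitions (n : nat) : seq (seq nat) :=
  [seq s <- partitions n | all odd s].

Definition distinct_partitions (n : nat) : seq (seq nat) :=
  [seq s <- partitions n | uniq s].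

Definition mult (nu : seq nat) (i : nat) : nat := count_mem i nu.

(* Only meaningful when 2 <= size l; pre2_image enforces this. *)
Definition pre2 (l : seq nat) : seq nat :=
  sort geq [seq nth 0 l i * nth 0 l j | i <- iota 0 (size l),
                                        j <- index_iota i.+1 (size l)].

(* The image is taken as a set: each partition in it is listed once. *)
Definition pre2_image (A : seq (seq nat)) : seq (seq nat) :=
  undup [seq pre2 l | l <- A & 2 <= size l].

Definition o2 (p n : nat) : nat :=
  \sum_(nu <- pre2_image (odd_partitions n)) mult nu p.

Definition d2 (p n : nat) : nat :=
  \sum_(nu <- pre2_image (distinct_partitions n)) mult nu p.

Lemma partitions_leP (k n : nat) (s : seq nat) :
  (s \in partitions_le k n) = is_partition n s && all (geq k) s.
Proof.
elim: k n s => [|k IHk] n s.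
  rewrite /=; case: s => [|x s].
    by rewrite /is_partition /= andbT eq_sym; case: n.
  case: eqP => _; rewrite ?inE /is_partition /=;
    by case: x => [|x] //=; rewrite ?andbF.
rewrite -[partitions_le _ _]/[seq nseq j k.+1 ++ t | j <- iota 0 (n %/ k.+1).+1,
  t <- partitions_le k (n - j * k.+1)].
apply/allpairsPdep/idP => [[j [t [jn]]]|].
  rewrite IHk => /andP[/and3P[st pt /eqP dt] kt] ->.
  have le_j : j * k.+1 <= n.
    by move: jn; rewrite mem_iota add0n ltnS /= leq_divRL.
  have sorted_geq u : sorted geq u = pairwise geq u.
    by rewrite sorted_pairwise // => a b c /= ab ca; exact: leq_trans ca ab.
  rewrite /is_partition sorted_geq pairwise_cat -!sorted_geq st andbT.
  rewrite !all_cat pt andbT sumn_cat sumn_nseq dt mulnC subnKC // eqxx andbT.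
  rewrite !all_nseq /= leqnn !orbT /= (sub_all _ kt) ?andbT; last first.
    by move=> a /= /leqW.
  apply/andP; split.
    apply/allrelP => a b /nseqP[-> _] /(allP kt) /= bk; exact: (@leqW b k bk).
  by rewrite sorted_geq; elim: j {jn le_j dt} => //= j ->; rewrite all_nseq /= leqnn orbT.
case/andP=> /and3P[ss ps /eqP ds] ks.
have [j [t [Es kt]]] : exists j t, s = nseq j k.+1 ++ t /\ all (geq k) t.
  elim: s ss ks {ps ds} => [|x s IHs] ss /=; first by exists 0, [::].
  case/andP=> xk ks.
  have [j [t [Es kt]]] := IHs (path_sorted ss) ks.
  have [->|xNk] := eqVneq x k.+1; first by exists j.+1, t; rewrite Es.
  exists 0, (x :: s); split=> //=.
  have lt_xk : x <= k by rewrite -ltnS ltn_neqAle xNk.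
  rewrite lt_xk /=; apply/allP => y ys /=; apply: leq_trans lt_xk.
  have tr : transitive geq by move=> a b c /= ab ca; exact: leq_trans ca ab.
  exact: (allP (order_path_min tr ss)).
have dn : k.+1 * j + sumn t = n by rewrite -ds Es sumn_cat sumn_nseq.
exists j, t; split=> //.
  by rewrite mem_iota add0n ltnS /= leq_divRL // -dn mulnC leq_addr.
rewrite IHk kt andbT /is_partition -dn mulnC addKn eqxx andbT.
move: ps; rewrite Es all_cat => /andP[_ ->]; rewrite andbT.
by move: ss; rewrite Es => /cat_sorted2[].
Qed.

Lemma mem_partitions (n : nat) (s : seq nat) :
  (s \in partitions n) = is_partition n s.
Proof.
rewrite partitions_leP; apply/andb_idr => /and3P[_ _ /eqP <-].
elim: s => //= x s /allP IHs; rewrite leq_addr; apply/allP => y /IHs /= ys.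
exact: leq_trans ys (leq_addl _ _).
Qed.

(* Main.v *)
(* Let e_k, p_k denote elementary symmetric polynomials and power sums of the
   parts. Then p_k^2 = p_2k + 2 e_2(x^k), so pre2 l and p_1(l) = n determine all
   the p_(2^j)(l), hence l (let j grow): pre2 is injective on the partitions of n.
   As p is prime, p occurs m(1) m(p) times in pre2 l, so o2 and d2 sum
   m(1) m(p) over odd, resp. distinct, partitions. Let g_i = 1 / (1 - x^i) and
   let E be the product of the 1 + x^i over i <> 1, p. By Euler's theorem the
   generating functions are x^(p+1) E ((1 + x) g_1) ((1 + x^p) g_p) and
   x^(p+1) E. Since (1 + x^i) g_i = 1 + 2 x^i g_i, their difference is twice a
   series with nonnegative coefficients. Series are truncated by working in a
   ring where x^(n+1) = 0, such as {poly int} modulo 'X^(n+1). *)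
Require Import Defs.
From HB Require Import structures.
From mathcomp Require Import all_boot all_algebra zify ring.
Set Implicit Arguments.
Unset Strict Implicit.
Unset Printing Implicit Defensive.
Import GRing.Theory Num.Theory.

(** * Pair products, and recovery of a partition from them *)

Fixpoint pair_products (s : seq nat) : seq nat :=
  if s is x :: s' then map (muln x) s' ++ pair_products s' else [::].

Lemma pre2E (s : seq nat) : pre2 s = sort geq (pair_products s).
Proof.
rewrite /pre2; congr sort; elim: s => //= x s IHs.
congr cat.
  rewrite -[in RHS](mkseq_nth 0 s) /mkseq -map_comp /index_iota subSS subn0.
  by rewrite (iotaDl 1 0) -map_comp.
rewrite -IHs (iotaDl 1 0) /allpairs_dep -map_comp; congr flatten.
apply: eq_map => i /=; rewrite add1n /index_iota /= subSS.
by rewrite (iotaDl 1 i.+1) -map_comp.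
Qed.

Lemma mult_pre2 (p : nat) (s : seq nat) :
  prime p -> mult (pre2 s) p = count_mem 1 s * count_mem p s.
Proof.
move=> pr_p; rewrite /mult pre2E (permP (permEl (perm_sort _ _))).
elim: s => //= x s IHs; rewrite count_cat count_map IHs.
have -> : count (preim (muln x) (pred1 p)) s =
    (x == 1) * count_mem p s + (x == p) * count_mem 1 s.
  have [->|x_neq1] := eqVneq x 1.
    rewrite mul1n [1 == p]eq_sym (negPf (_ : p != 1)) ?mul0n ?addn0.
      by apply: eq_count => y /=; rewrite mul1n.
    by rewrite neq_ltn prime_gt1 ?orbT.
  have [->|x_neqp] := eqVneq x p.
    rewrite mul0n mul1n; apply: eq_count => y /=.
    by rewrite -{2}[p]muln1 eqn_pmul2l ?prime_gt0.
  rewrite !mul0n; apply/eqP; rewrite -leqn0 leqNgt -has_count.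
  apply/hasPn => y _ /=; apply: contra_neqN x_neqp => /eqP xy.
  have /primeP[_ /(_ x)] := pr_p.
  by rewrite -xy dvdn_mulr // (negPf x_neq1) => /(_ isT) /eqP.
(* [x] cannot be both 1 and [p], so the cross term of the expanded product vanishes. *)
have : (x == 1) * (x == p) = 0.
  by case: eqP => // ->; case: eqP => // p1; rewrite -p1 in pr_p.
by case: (x == 1); case: (x == p) => //=; lia.
Qed.

Lemma power_sum_pair_products (k : nat) (s : seq nat) :
  (\sum_(x <- s) x ^ k) ^ 2 =
    \sum_(x <- s) x ^ k.*2 + 2 * \sum_(y <- pair_products s) y ^ k.
Proof.
elim: s => [|x s IHs] /=; first by rewrite !big_nil.
rewrite !big_cons big_cat big_map /= sqrnD IHs -!mulnn.
under [X in _ = _ + 2 * (X + _)]eq_bigr do rewrite expnMn.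
rewrite -big_distrr -addnn expnD /=; ring.
Qed.

(** For large exponents the greatest part dominates the power sum, so the heads agree; they cancel,
    and the tails follow by induction. *)
Lemma power_sums_inj (s t : seq nat) :
  sorted geq s -> sorted geq t -> all (leq 1) s -> all (leq 1) t ->
  (forall k, \sum_(x <- s) x ^ 2 ^ k = \sum_(x <- t) x ^ 2 ^ k) -> s = t.
Proof.
have geq_tr : transitive geq by move=> a b c /= ab ca; exact: leq_trans ca ab.
have head_le x y s' t' : sorted geq (y :: t') -> 0 < y ->
    (forall k, \sum_(z <- x :: s') z ^ 2 ^ k = \sum_(z <- y :: t') z ^ 2 ^ k) ->
    x <= y.
  move=> st y_gt0 E; rewrite leqNgt; apply/negP => lt_yx.
  (* The [m] parts of [y :: t'] are at most [y], so their power sum is at most [m * y ^ K]. Once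
     [K > y * m], this is less than [y.+1 ^ K]. *)
  pose m := (size t').+1; pose K := 2 ^ (y * m).
  have K_gt : y * m < K by apply: ltn_expl.
  have := E (y * m); rewrite -/K => EK.
  have : y.+1 ^ K <= m * y ^ K.
    apply: (@leq_trans (\sum_(z <- x :: s') z ^ K)).
      rewrite big_cons; apply: leq_trans (leq_addr _ _).
      by rewrite leq_exp2r // (leq_ltn_trans _ K_gt).
    have -> : m * y ^ K = \sum_(z <- y :: t') y ^ K.
      by rewrite big_const_seq count_predT iter_addn_0 mulnC.
    rewrite EK big_seq [leqRHS]big_seq; apply: leq_sum => z; rewrite inE.
    rewrite leq_exp2r ?(leq_ltn_trans _ K_gt) //.
    by case/predU1P => [->//|zt]; exact: (allP (order_path_min geq_tr st)).
  apply/negP; rewrite -ltnNge.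
  (* Bernoulli's inequality for [(1 + 1/y) ^ K], cleared of denominators. *)
  have : y ^ K * (y + K) <= y * y.+1 ^ K.
    elim: K {K_gt EK} => [|K IHK]; first by rewrite !expn0; lia.
    by rewrite !expnS; nia.
  have : 0 < y ^ K by rewrite expn_gt0 y_gt0.
  by move: K_gt; nia.
elim: s t => [|x s IHs] [|y t] // ss st.
- by move=> _ /= /andP[y_gt0 _] /(_ 0); rewrite big_nil big_cons; lia.
- by move=> /= /andP[x_gt0 _] _ /(_ 0); rewrite big_nil big_cons; lia.
move=> /= /andP[x_gt0 s_gt0] /andP[y_gt0 t_gt0] E.
have xy : x = y.
  apply/anti_leq/andP; split; first exact: head_le E.
  by apply: head_le ss x_gt0 _ => k; exact/esym/E.
subst y; congr cons; apply: IHs (path_sorted ss) (path_sorted st) s_gt0 t_gt0 _.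
by move=> k; have := E k; rewrite !big_cons => /addnI.
Qed.

Lemma pre2_inj (n : nat) : {in partitions n &, injective pre2}.
Proof.
move=> s t; rewrite !mem_partitions.
move=> /and3P[ss s_gt0 /eqP sum_s] /and3P[st t_gt0 /eqP sum_t].
rewrite !pre2E => Est; have {Est} perm_st : perm_eq (pair_products s) (pair_products t).
  by rewrite -(perm_sort geq) Est perm_sort.
apply: power_sums_inj => // k; elim: k => [|k IHk].
  have sumE u : \sum_(x <- u) x ^ 2 ^ 0 = sumn u.
    by rewrite sumnE; apply: eq_bigr => i _; rewrite expn1.
  by rewrite !sumE sum_s.
have := power_sum_pair_products (2 ^ k) s.
rewrite IHk power_sum_pair_products (perm_big _ perm_st) => /addIn.
by rewrite expnS mul2n.
Qed.

(** * From images under [pre2] to sums over partitions *)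

Lemma uniq_partitions_le (k n : nat) : uniq (partitions_le k n).
Proof.
elim: k n => [|k IHk] n; first by rewrite /=; case: ifP.
apply: allpairs_uniq_dep => [|j _|]; first exact: iota_uniq.
  exact: IHk.
move=> _ _ /allpairsPdep[i [s [_ sP ->]]] /allpairsPdep[j [t [_ tP ->]]] /= E.
(* The remaining parts are at most [k], so the number of copies of [k.+1] can be read off the whole
   list. *)
have cnt u m : u \in partitions_le k m -> count_mem k.+1 u = 0.
  rewrite partitions_leP => /andP[_ /allP ku]; apply/count_memPn/negP => /ku /=.
  by rewrite ltnn.
have ij : i = j.
  have := congr1 (count_mem k.+1) E.
  by rewrite !count_cat !count_nseq /= eqxx (cnt _ _ sP) (cnt _ _ tP); lia.
by subst j; move/eqP: E; rewrite eqseq_cat // eqxx /= => /eqP ->.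
Qed.

(** By injectivity [undup] removes nothing. Partitions with fewer than two parts may be included, as
    they cannot contain both 1 and [p]. *)
Lemma sum_pre2_image (a : pred (seq nat)) (n p : nat) : prime p ->
  \sum_(nu <- pre2_image [seq s <- partitions n | a s]) mult nu p =
    \sum_(s <- partitions n | a s) count_mem 1 s * count_mem p s.
Proof.
move=> pr_p; rewrite /pre2_image undup_id; last first.
  rewrite map_inj_in_uniq; first by rewrite !filter_uniq ?uniq_partitions_le.
  by move=> s t; rewrite !mem_filter => /and3P[_ _ sP] /and3P[_ _]; exact: pre2_inj.
rewrite big_map big_filter big_filter_cond.
rewrite [RHS](bigID (fun s => 1 < size s)) /= [X in _ = _ + X]big1 ?addn0.
  by apply: eq_big => // s _; rewrite mult_pre2.
move=> [|x [|y s]] //=; rewrite ?andbF // => _; rewrite !addn0.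
by case: eqP => // ->; case: eqP => // p1; rewrite -p1 in pr_p.
Qed.


(* Marking the parts 1 and p by their multiplicity makes the weight of a
   partition equal to the multiplicity of p in its image under pre2. *)
Definition marked (p : nat) (h : nat -> nat -> bool) (i j : nat) : nat :=
  h i j * (if i \in [:: 1; p] then j else 1).

(** * Generating functions at a nilpotent element *)

Section GeneratingFunctions.
Local Open Scope ring_scope.

(** The weight [c i j] is given to a part [i] occurring [j] times. The point [x] is arbitrary so
    that it can be both ['X] and its nilpotent image. *)
Definition part_gf (R : nzRingType) (x : R) (c : nat -> nat -> nat) (k n : nat) : R :=
  \prod_(1 <= i < k.+1) \sum_(0 <= j < n.+1) x ^+ (i * j) *+ c i j.

Section Nilpotent.

Variables (A : comNzRingType) (n : nat) (x : A).
Hypothesis x_nilp : x ^+ n.+1 = 0.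

Definition geom (i : nat) : A := \sum_(0 <= j < n.+1) x ^+ (i * j).

Lemma expr_nilp i : (n < i)%N -> x ^+ i = 0.
Proof. by move=> lt_ni; rewrite -(subnKC lt_ni) exprD x_nilp mul0r. Qed.

Lemma geomK i : (0 < i)%N -> (1 - x ^+ i) * geom i = 1.
Proof.
move=> i_gt0; have yN : (x ^+ i) ^+ n.+1 = 0 by rewrite -exprM expr_nilp //; nia.
rewrite /geom; under eq_bigr do rewrite exprM.
by rewrite big_mkord -opprB mulNr -subrX1 yN sub0r opprK.
Qed.

(** With [y = x ^+ i] this is the series y / (1 - y)^2: marking a part multiplies its factor
    [geom i] by [x ^+ i * geom i]. *)
Lemma sum_mulrn_geom i : (0 < i)%N ->
  \sum_(0 <= j < n.+1) x ^+ (i * j) *+ j = x ^+ i * geom i ^+ 2.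
Proof.
move=> i_gt0; have yN : (x ^+ i) ^+ n.+1 = 0 by rewrite -exprM expr_nilp //; nia.
have gK := geomK i_gt0.
have W m : (1 - x ^+ i) * (\sum_(0 <= j < m) x ^+ (i * j) *+ j) =
    x ^+ i * (\sum_(0 <= j < m) x ^+ (i * j)) - (x ^+ i) ^+ m *+ m.
  elim: m => [|m IHm]; first by rewrite !big_geq // mulr0n !mulr0 subr0.
  rewrite !big_nat_recr //= !mulrDr IHm [_ ^+ m.+1]exprS exprM.
  by rewrite mulrS; ring.
have {}W := W n.+1; rewrite yN mul0rn subr0 -/(geom i) in W.
by rewrite -[LHS]mul1r -{1}gK [_ * geom i]mulrC -mulrA W mulrCA expr2.
Qed.

Lemma euler_distinct_odd :
  \prod_(1 <= i < n.+1) (1 + x ^+ i) = \prod_(1 <= i < n.+1 | odd i) geom i.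
Proof.
have cancel : \prod_(1 <= i < n.+1) (1 - x ^+ i) * \prod_(1 <= i < n.+1) geom i = 1.
  rewrite -big_split big_nat big1 // => i /andP[i_gt0 _]; exact: geomK.
(* The product of all [1 - x ^+ i] is invertible by [cancel]. Multiplied by it, both sides reduce to
   the factors with even exponent. *)
suff E : (\prod_(1 <= i < n.+1) (1 + x ^+ i)) * \prod_(1 <= i < n.+1) (1 - x ^+ i) =
    (\prod_(1 <= i < n.+1 | odd i) geom i) * \prod_(1 <= i < n.+1) (1 - x ^+ i).
  by rewrite -[LHS]mulr1 -[RHS]mulr1 -[X in _ * X = _ * X]cancel !mulrA E.
rewrite -big_split /=.
under eq_bigr do rewrite mulrC -subr_sqr expr1n -exprM muln2.
have -> : \prod_(1 <= i < n.+1) (1 - x ^+ i.*2) =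
    \prod_(1 <= i < n.*2.+1 | ~~ odd i) (1 - x ^+ i).
  elim: (X in \prod_(1 <= i < X.+1) _ = \prod_(1 <= i < (X.*2).+1 | _) _) => [|m IHm].
    by rewrite !big_geq.
  rewrite big_nat_recr //= IHm doubleS big_mkcond [in RHS]big_mkcond.
  by rewrite [in RHS]big_nat_recr 1?[in RHS]big_nat_recr //= negbK odd_double /= mulr1.
(* Exponents above [n] give factors 1. *)
rewrite (@big_cat_nat _ _ _ n.+1) //=; last by rewrite ltnS -addnn leq_addr.
rewrite [X in _ * X]big_nat_cond [X in _ * X]big1 ?mulr1; last first.
  by move=> i /andP[/andP[lt_ni _] _]; rewrite expr_nilp ?subr0.
rewrite [X in _ = _ * X](bigID odd) /= mulrA -big_split /=.
rewrite [X in _ = X * _]big_nat_cond [X in _ = X * _]big1 ?mul1r //.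
by move=> i /andP[/andP[i_gt0 _] _]; rewrite mulrC geomK.
Qed.

Lemma odd_minus_distinct (p : nat) : odd p -> (1 < p <= n)%N ->
  let E := \prod_(1 <= i < n.+1 | (i != 1) && (i != p)) (1 + x ^+ i) in
  part_gf x (marked p (fun i j => odd i || (j == 0%N))) n n =
  part_gf x (marked p (fun _ j => (j <= 1)%N)) n n +
  (x * x ^+ p * E *
   (x * geom 1 + x ^+ p * geom p + (x * x ^+ p * geom 1 * geom p) *+ 2)) *+ 2.
Proof.
move=> odd_p /andP[p_gt1 le_pn] E; rewrite /part_gf /marked.
have p_neq1 : (p != 1)%N by rewrite neq_ltn p_gt1 orbT.
have in1 : (1 \in index_iota 1 n.+1)%N by rewrite mem_index_iota; lia.
have inp : (p \in index_iota 1 n.+1)%N by rewrite mem_index_iota; lia.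
have pick2 (F : nat -> A) : \prod_(1 <= i < n.+1) F i =
    F 1 * (F p * \prod_(1 <= i < n.+1 | (i != 1) && (i != p)) F i).
  rewrite (bigD1_seq 1) ?iota_uniq //= -big_filter (bigD1_seq p) ?filter_uniq ?iota_uniq //=.
    by rewrite big_filter_cond.
  by rewrite mem_filter p_neq1.
(* An even part only admits [j = 0] and gives 1. Both marked parts, 1 and [p], are odd. *)
have -> : \prod_(1 <= i < n.+1)
     \sum_(0 <= j < n.+1)
        x ^+ (i * j) *+ ((odd i || (j == 0%N)) * (if i \in [:: 1; p] then j else 1)) =
    \prod_(1 <= i < n.+1 | odd i) geom i *
    \prod_(1 <= i < n.+1) (if i \in [:: 1; p] then x ^+ i * geom i else 1).
  rewrite [X in _ = X * _]big_mkcond -big_split /= !big_nat.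
  apply: eq_bigr => i /andP[i_gt0 _].
  have [i1p|iN1p] := boolP (i \in [:: 1; p]%N).
    have -> : odd i by move: i1p; rewrite !inE => /pred2P[]->.
    rewrite mulrCA -expr2 -sum_mulrn_geom //.
    by under eq_bigr do rewrite mul1n.
  rewrite mulr1; under eq_bigr do rewrite muln1.
  case: (odd i) => //=.
  rewrite big_nat_recl // muln0 big1 ?addr0 //.
(* At a marked part [c 0 = 0], which leaves [x ^+ i] in place of [1 + x ^+ i]. *)
have le2 c i : \sum_(0 <= j < n.+1) x ^+ (i * j) *+ ((j <= 1) * c j) =
    1 *+ c 0 + x ^+ i *+ c 1.
  rewrite big_ltn // big_ltn; last lia.
  rewrite big_nat big1 ?addr0; last first.
    by move=> j /andP[j_gt1 _]; rewrite leqNgt j_gt1.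
  by rewrite muln0 muln1 !mul1n expr0.
under [in RHS]eq_bigr do rewrite le2.
rewrite -euler_distinct_odd !pick2 !inE !eqxx orbT mulr0n add0r mulr1n.
rewrite mulr1n !expr1 /=.
rewrite [X in _ * (_ * (_ * X))]big1; last first.
  by move=> i /andP[i1 ip]; rewrite !inE (negPf i1) (negPf ip).
have -> : \prod_(1 <= i < n.+1 | (i != 1) && (i != p))
      ((if i \in [:: 1; p] then 0 else 1)%:R +
       x ^+ i *+ (if i \in [:: 1; p] then 1 else 1)) = E.
  by apply: eq_bigr => i /andP[i1 ip]; rewrite !inE (negPf i1) (negPf ip).
have gE i : (0 < i)%N -> (1 + x ^+ i) * geom i = 1 + (x ^+ i * geom i) *+ 2.
  by move=> /geomK gK; rewrite -[X in X + _ *+ 2]gK; ring.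
transitivity (x * x ^+ p * E * (((1 + x ^+ 1) * geom 1) * ((1 + x ^+ p) * geom p))).
  by rewrite expr1 -/E; ring.
by rewrite !gE ?(ltnW p_gt1) // expr1; ring.
Qed.
End Nilpotent.

(** * Return to coefficients of integer polynomials *)

Lemma in_qpolyXn_coef (R : comNzRingType) (n : nat) (P Q : {poly R}) (i : nat) :
  in_qpoly 'X^(n.+1) P = in_qpoly 'X^(n.+1) Q -> (i <= n)%N -> P`_i = Q`_i.
Proof.
move=> /(congr1 val) /=; rewrite mk_monic_Xn /= => E le_in.
have monX := monicXn R n.+1.
rewrite (Pdiv.RingMonic.rdivp_eq monX P) (Pdiv.RingMonic.rdivp_eq monX Q) E.
by rewrite !coefD !coefMXn ltnS le_in.
Qed.

Lemma in_qpolyX_nilp (R : comNzRingType) (n : nat) :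
  (in_qpoly ('X^(n.+1) : {poly R}) 'X) ^+ n.+1 = 0.
Proof.
rewrite -rmorphXn; apply: val_inj; rewrite /= mk_monic_Xn /=.
by rewrite Pdiv.RingMonic.rmodpp ?monicXn.
Qed.

Lemma rmorph_part_gf (R S : nzRingType) (f : {rmorphism R -> S}) (x : R) c k n :
  f (part_gf x c k n) = part_gf (f x) c k n.
Proof.
rewrite rmorph_prod; apply: eq_bigr => i _; rewrite rmorph_sum.
by apply: eq_bigr => j _; rewrite rmorphMn rmorphXn.
Qed.

Lemma rmorph_geom (R S : comNzRingType) (f : {rmorphism R -> S}) n (x : R) i :
  f (geom n x i) = geom n (f x) i.
Proof. by rewrite rmorph_sum; apply: eq_bigr => j _; rewrite rmorphXn. Qed.

(** Expanding the last factor chooses the multiplicity of the part [k], as [partitions_le] does. The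
    bound [N] stays fixed while [n] decreases in the induction. *)
Lemma coef_part_gf (c : nat -> nat -> nat) (k n N : nat) : (n <= N)%N ->
  (part_gf ('X : {poly int}) c k N)`_n =
    (\sum_(s <- partitions_le k n) \prod_(1 <= i < k.+1) c i (count_mem i s))%:R.
Proof.
rewrite /part_gf; elim: k n => [|k IHk] n le_nN.
  rewrite big_geq // coef1 /=; case: ifP => _; rewrite ?big_nil //.
  by rewrite big_seq1 big_geq.
rewrite -[partitions_le k.+1 n]/[seq nseq j k.+1 ++ s
  | j <- iota 0 (n %/ k.+1).+1, s <- partitions_le k (n - j * k.+1)].
rewrite big_allpairs_dep -[iota 0 _]/(index_iota 0 (n %/ k.+1).+1).
rewrite [in LHS]big_nat_recr //= mulr_sumr coef_sum.
have le_dN : ((n %/ k.+1).+1 <= N.+1)%N.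
  by rewrite ltnS (leq_trans (leq_div _ _)).
(* The terms with [j * k.+1 > n] do not reach the coefficient [n]. *)
rewrite (big_cat_nat _ le_dN) //= [X in _ + X]big_nat [X in _ + X]big1 ?addr0; last first.
  move=> j /andP[lt_j _]; rewrite mulrnAr coefMn coefMXn.
  by rewrite mulnC -ltn_divLR // lt_j mul0rn.
rewrite natr_sum; apply: eq_big_nat => j /=; rewrite ltnS leq_divRL // => le_jn.
rewrite mulrnAr coefMn coefMXn ltnNge mulnC le_jn /= IHk; last first.
  exact: leq_trans (leq_subr _ _) le_nN.
rewrite -[LHS]mulr_natr -natrM big_distrl /=; congr (_%:R).
rewrite !big_seq; apply: eq_bigr => s; rewrite partitions_leP => /andP[_ /allP ks].
rewrite [RHS]big_nat_recr //=; congr (_ * _)%N.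
  apply: eq_big_nat => i /andP[_ lt_ik].
  by rewrite count_cat count_nseq /= [k.+1 == i]eq_sym ltn_eqF // mul0n.
rewrite count_cat count_nseq /= eqxx mul1n.
have /count_memPn -> : k.+1 \notin s by apply/negP => /ks /=; rewrite ltnn.
by rewrite addn0.
Qed.

Lemma prodn_bool (b : nat -> bool) (r : seq nat) : (\prod_(i <- r) b i)%N = all b r.
Proof.
by elim: r => [|i r IHr]; rewrite ?big_nil // big_cons IHr /=; case: (b i); rewrite ?mul1n.
Qed.

Lemma prod_mult_pair (p n : nat) (F : nat -> nat) : (1 < p <= n)%N ->
  (\prod_(1 <= i < n.+1) (if i \in [:: 1; p] then F i else 1) = F 1 * F p)%N.
Proof.
move=> /andP[p_gt1 le_pn]; have p_neq1 : (p != 1)%N by rewrite neq_ltn p_gt1 orbT.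
rewrite -big_mkcond -big_filter (perm_big [:: 1; p]%N) /= ?big_cons ?big_nil ?muln1 //.
apply: uniq_perm => [||i]; rewrite ?filter_uniq ?iota_uniq //=.
  by rewrite inE eq_sym p_neq1.
by rewrite mem_filter mem_index_iota !inE; case: eqP => [->|_] /=; lia.
Qed.

Lemma all_oddE (n : nat) (s : seq nat) : is_partition n s -> all (geq n) s ->
  all (fun i => odd i || (count_mem i s == 0%N)) (index_iota 1 n.+1) = all odd s.
Proof.
move=> /and3P[_ /allP s_gt0 _] /allP sn; apply/allP/allP => H i.
  move=> si; have := H i; rewrite mem_index_iota ltnS.
  move=> /(_ (introT andP (conj (s_gt0 _ si) (sn _ si)))) /orP[//|/eqP/count_memPn]; by rewrite si.
move=> _; have [/H-> //|/count_memPn->] := boolP (i \in s).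
by rewrite orbT.
Qed.

Lemma all_uniqE (n : nat) (s : seq nat) : is_partition n s -> all (geq n) s ->
  all (fun i => (count_mem i s <= 1)%N) (index_iota 1 n.+1) = uniq s.
Proof.
move=> /and3P[_ /allP s_gt0 _] /allP sn; apply/allP/idP => [H|us i _].
  apply: count_mem_uniq => i; have [si|/count_memPn -> //] := boolP (i \in s).
  apply/anti_leq; rewrite H; last first.
    by rewrite mem_index_iota ltnS; apply/andP; split; [exact: s_gt0 | exact: sn].
  by rewrite -has_count has_pred1.
by rewrite count_uniq_mem // leq_b1.
Qed.

(** In the weight of [s], the factors [h] multiply to the indicator of [a s] and the marks to the
    two multiplicities. *)
Lemma sum_mult_gf (a : pred (seq nat)) (h : nat -> nat -> bool) (n p : nat) :
  (1 < p <= n)%N ->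
  (forall s, is_partition n s -> all (geq n) s ->
     all (fun i => h i (count_mem i s)) (index_iota 1 n.+1) = a s) ->
  (\sum_(s <- partitions n | a s) count_mem 1 s * count_mem p s)%N%:R =
  (part_gf ('X : {poly int}) (marked p h) n n)`_n.
Proof.
move=> le_pn ha; rewrite coef_part_gf //; congr (_%:R).
rewrite big_mkcond big_seq [RHS]big_seq; apply: eq_bigr => s.
rewrite partitions_leP => /andP[ps sn].
rewrite /marked big_split /= prodn_bool prod_mult_pair // ha //.
by case: (a s); rewrite ?mul1n.
Qed.

Lemma sum_odd_distinct (n p : nat) : odd p -> (1 < p <= n)%N ->
  exists w : nat,
    (\sum_(s <- partitions n | all odd s) count_mem 1 s * count_mem p s =
     (\sum_(s <- partitions n | uniq s) count_mem 1 s * count_mem p s) + w * 2)%N.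
Proof.
move=> hodd p_bd.
have Eo := @sum_mult_gf (all odd) (fun i j => odd i || (j == 0%N)) _ _ p_bd (@all_oddE n).
have Ed := @sum_mult_gf uniq (fun _ j => (j <= 1)%N) _ _ p_bd (@all_uniqE n).
pose E : {poly int} := \prod_(1 <= i < n.+1 | (i != 1) && (i != p)) (1 + 'X^i).
pose g : nat -> {poly int} := geom n 'X.
(* The half difference from [odd_minus_distinct], lifted to integer polynomials, where its
   coefficients are visibly nonnegative. *)
pose W : {poly int} := 'X * 'X^p * E *
  ('X * g 1%N + 'X^p * g p + ('X * 'X^p * g 1%N * g p) *+ 2).
(* The closure instances are found on nneg_num_pred but not on Num.nneg. *)
have W_ge0 : W \is a polyOver (@Num.Def.nneg_num_pred int).
  have g_ge0 i : g i \is a polyOver (@Num.Def.nneg_num_pred int).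
    by rewrite /g /geom; apply: rpred_sum => j _; rewrite rpredX ?polyOverX.
  have E_ge0 : E \is a polyOver (@Num.Def.nneg_num_pred int).
    by apply: rpred_prod => i _; rewrite rpredD ?rpred1 ?rpredX ?polyOverX.
  by rewrite !(rpredM, rpredD, rpredMn, rpredX, polyOverX).
have Wn_ge0 : 0 <= W`_n by exact: (polyOverP W_ge0).
exists (absz W`_n).
apply/eqP; rewrite -(eqr_nat int) natrD natrM natr_absz ger0_norm // intz.
rewrite Eo Ed mulr_natr -coefMn -coefD; apply/eqP.
apply: in_qpolyXn_coef (leqnn n).
pose f : {rmorphism {poly int} -> {poly %/ 'X^(n.+1)}} := in_qpoly 'X^(n.+1).
have fX_nilp : f 'X ^+ n.+1 = 0 by exact: in_qpolyX_nilp.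
change (f (part_gf 'X (marked p (fun i j => odd i || (j == 0%N))) n n) =
  f (part_gf 'X (marked p (fun _ j => (j <= 1)%N)) n n + W *+ 2)).
rewrite rmorphD !rmorph_part_gf (odd_minus_distinct fX_nilp hodd p_bd).
congr (_ + _); rewrite rmorphMn /W !(rmorphM, rmorphD, rmorphMn) rmorphXn /g !rmorph_geom.
congr (_ * _ * _ *+ _).
rewrite /E rmorph_prod; apply: eq_bigr => i _.
by rewrite rmorphD rmorph1 rmorphXn.
Qed.

End GeneratingFunctions.

Theorem theorem3p9 (n p : nat) (hp : prime p) (hodd : odd p) :
  o2 p n >= d2 p n /\ o2 p n = d2 p n %[mod 2].
Proof.
rewrite /o2 /d2 !sum_pre2_image //.
(* If [p > n], no part equals [p] and both sums are 0; otherwise the product has a factor at [p] to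
   single out. *)
have [lt_np|le_pn] := ltnP n p.
  have E0 (a : pred (seq nat)) :
      (\sum_(s <- partitions n | a s) count_mem 1 s * count_mem p s = 0)%N.
    rewrite big_seq_cond big1 // => s; rewrite partitions_leP.
    move=> /andP[/andP[_ /allP sn] _].
    have /count_memPn -> : p \notin s by apply/negP => /sn /=; rewrite leqNgt lt_np.
    by rewrite muln0.
  by rewrite !E0.
have p_bd : 1 < p <= n by rewrite prime_gt1.
have [w ->] := sum_odd_distinct hodd p_bd.
by rewrite leq_addr addnC modnMDl.
Qed.
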